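(* Let $G$ be a finite abelian group (written additively) of odd order $N$, put $M=(N-1)/2$, and let $x\in G$, $x\ne0$, have order $m$. Then $$H_x\cong P_{(m-1)/2}\ \sqcup\ \frac{N/m-1}{2}\,C_m,$$ that is, $H_x$ is the disjoint union of a path on $(m-1)/2$ vertices and $\frac{N/m-1}{2}$ cycles of length $m$. In particular, $$|E(H_x)|=M-1.$$ Every edge of the complete graph on $\mathcal Q_G$ belongs to precisely two target graphs. Moreover, if $x,y\in G\setminus\{0\}$ satisfy $[x]\ne[y]$, then $H_x$ and $H_y$ have the unique common edge $$\left\{\left[\frac{x+y}{2}\right],\left[\frac{x-y}{2}\right]\right\}.$$
   Context: $\mathcal Q_G=(G\setminus\{0\})/\{\pm1\}$ is the set of inversion classes $[a]=\{a,-a\}$ of nonzero elements of $G$; since $N$ is odd each class has two elements and $|\mathcal Q_G|=M$. For $x\in G\setminus\{0\}$, the target graph $H_x$ is the simple graph with vertex set $\mathcal Q_G$ in which distinct classes $[a]$ and $[b]$ are adjacent if and only if $x=\varepsilon a+\delta b$ for some $\varepsilon,\delta\in\{\pm1\}$. Since $H_x=H_{-x}$, target graphs are indexed by target classes $[x]\in\mathcal Q_G$; ''belongs to precisely two target graphs'' means that exactly two classes $[x]\in\mathcal Q_G$ have $H_x$ containing the edge. $P_s$ denotes the path on $s$ vertices, $C_m$ the cycle on $m$ vertices, $kC_m$ the disjoint union of $k$ copies of $C_m$. For $g\in G$, $g/2$ denotes the unique $h\in G$ with $2h=g$ (doubling is a bijection since $N$ is odd). *)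

(* Defs.v *)
From mathcomp Require Import all_boot all_order all_fingroup all_algebra.

Set Implicit Arguments.
Unset Strict Implicit.
Unset Printing Implicit Defensive.

Import GRing.Theory.
Local Open Scope ring_scope.

Record sgraph (T : finType) := SGraph {
  adj :> rel T;
  adj_sym : symmetric adj;
  adj_irr : irreflexive adj }.

Definition edges (T : finType) (H : sgraph T) : {set {set T}} :=
  [set [set p.1; p.2] | p : T * T & H p.1 p.2].

Definition isomorphic (T U : finType) (H : sgraph T) (K : sgraph U) : Prop :=
  exists2 f : T -> U, bijective f & forall u v, K (f u) (f v) = H u v.

Section Constructions.

Definition complete_rel (T : finType) : rel T := [rel u v | u != v].

Fact complete_sym (T : finType) : symmetric (@complete_rel T).
Proof. by move=> u v; rewrite /complete_rel /= eq_sym. Qed.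

Fact complete_irr (T : finType) : irreflexive (@complete_rel T).
Proof. by move=> u; rewrite /complete_rel /= eqxx. Qed.

Definition complete (T : finType) : sgraph T :=
  SGraph (@complete_sym T) (@complete_irr T).

Definition path_rel (s : nat) : rel 'I_s :=
  [rel i j : 'I_s | (i.+1 == j :> nat) || (j.+1 == i :> nat)].

Fact path_sym s : symmetric (@path_rel s).
Proof. by move=> i j; rewrite /path_rel /= orbC. Qed.

Fact path_irr s : irreflexive (@path_rel s).
Proof. by move=> i; rewrite /path_rel /= orbb gtn_eqF. Qed.

Definition path_graph (s : nat) : sgraph 'I_s :=
  SGraph (@path_sym s) (@path_irr s).

(* The usual cycle for m >= 3; the condition i != j only matters for m = 1. *)
Definition cycle_rel (m : nat) : rel 'I_m :=
  [rel i j : 'I_m | (i != j) && ((j == ordS i) || (i == ordS j))].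

Fact cycle_sym m : symmetric (@cycle_rel m).
Proof. by move=> i j; rewrite /cycle_rel /= eq_sym orbC. Qed.

Fact cycle_irr m : irreflexive (@cycle_rel m).
Proof. by move=> i; rewrite /cycle_rel /= eqxx. Qed.

Definition cycle_graph (m : nat) : sgraph 'I_m :=
  SGraph (@cycle_sym m) (@cycle_irr m).

Variables (T U : finType) (H : sgraph T) (K : sgraph U).

Definition disjoint_union_rel : rel (T + U)%type := fun p q =>
  match p, q with
  | inl u, inl v => H u v
  | inr u, inr v => K u v
  | _, _ => false
  end.

Fact disjoint_union_sym : symmetric disjoint_union_rel.
Proof. by case=> u [] v //=; exact: adj_sym. Qed.

Fact disjoint_union_irr : irreflexive disjoint_union_rel.
Proof. by case=> u /=; exact: adj_irr. Qed.

Definition disjoint_union : sgraph (T + U)%type :=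
  SGraph disjoint_union_sym disjoint_union_irr.

Definition copies_rel (k : nat) : rel ('I_k * T)%type :=
  [rel p q : 'I_k * T | (p.1 == q.1) && H p.2 q.2].

Fact copies_sym k : symmetric (@copies_rel k).
Proof. by move=> p q; rewrite /copies_rel /= eq_sym adj_sym. Qed.

Fact copies_irr k : irreflexive (@copies_rel k).
Proof. by move=> p; rewrite /copies_rel /= adj_irr andbF. Qed.

Definition copies (k : nat) : sgraph ('I_k * T)%type :=
  SGraph (@copies_sym k) (@copies_irr k).

End Constructions.

Section TargetGraphs.

Variable G : finZmodType.
Implicit Types (a b x g h : G).

Definition inv_class a : {set G} := [set a; - a].

Definition inv_classes : {set {set G}} :=
  [set inv_class a | a : G & a != 0].

Definition QG : finType := {A : {set G} | A \in inv_classes}.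

Fact inv_class_in a : a != 0 -> inv_class a \in inv_classes.
Proof. by move=> a0; apply/imsetP; exists a; rewrite ?inE. Qed.

Definition cls a (a0 : a != 0) : QG := Sub (inv_class a) (inv_class_in a0).

Definition signed (s : bool) a : G := if s then - a else a.

Definition target_rel x : rel QG := [rel u v : QG | (u != v) &&
  [exists a, exists b, [&& val u == inv_class a, val v == inv_class b
    & [exists s, exists t, x == signed s a + signed t b]]]].

Fact target_sym x : symmetric (target_rel x).
Proof.
suff imp u v : target_rel x u v -> target_rel x v u.
  by move=> u v; apply/idP/idP; exact: imp.
case/andP=> uv /existsP[a /existsP[b /and3P[ua vb /existsP[s /existsP[t e]]]]].
rewrite /target_rel /= eq_sym uv; apply/existsP; exists b; apply/existsP; exists a.
rewrite ua vb; apply/existsP; exists t; apply/existsP; exists s.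
by rewrite addrC.
Qed.

Fact target_irr x : irreflexive (target_rel x).
Proof. by move=> u; rewrite /target_rel /= eqxx. Qed.

Definition target x : sgraph QG := SGraph (@target_sym x) (@target_irr x).

Lemma inv_class_eq a b : (inv_class a == inv_class b) = (a == b) || (a == - b).
Proof.
apply/eqP/idP=> [ab|/orP[]/eqP->//].
  by have := set21 a (- a); rewrite -/(inv_class a) ab !inE.
by rewrite /inv_class opprK setUC.
Qed.

(* Adjacency does not depend on the chosen representatives. *)
Lemma targetE x a b (a0 : a != 0) (b0 : b != 0) :
  target x (cls a0) (cls b0) = (cls a0 != cls b0) &&
    [exists s, exists t, x == signed s a + signed t b].
Proof.
rewrite /= /target_rel /=; congr (_ && _); apply/idP/idP; last first.
  by move=> h; apply/existsP; exists a; apply/existsP; exists b; rewrite !eqxx.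
case/existsP=> a' /existsP[b' /and3P[]]; rewrite !inv_class_eq => ea eb.
case/existsP=> s /existsP[t /eqP->].
have sgn c c' r : (c == c') || (c == - c') -> exists r', signed r c' = signed r' c.
  case/orP=> /eqP->; first by exists r.
  by exists (~~ r); case: r; rewrite /= ?opprK.
have [s' ->] := sgn _ _ s ea; have [t' ->] := sgn _ _ t eb.
by apply/existsP; exists s'; apply/existsP; exists t'.
Qed.

Lemma targetN x : target (- x) =2 target x.
Proof.
have imp z u v : target z u v -> target (- z) u v.
  case/andP=> uv /existsP[a /existsP[b /and3P[ua vb]]].
  case/existsP=> s /existsP[t /eqP->].
  apply/andP; split=> //; apply/existsP; exists a; apply/existsP; exists b.
  rewrite ua vb; apply/existsP; exists (~~ s); apply/existsP; exists (~~ t).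
  by rewrite opprD; case: s; case: t; rewrite /= ?opprK.
by move=> u v; apply/idP/idP=> /imp; rewrite ?opprK.
Qed.

Definition half_elt g : G := odflt 0 [pick h | h *+ 2 == g].

(* For #|G| odd, half_elt g is the unique h such that 2h = g. *)
Lemma half_eltP g h : odd #|G| -> (h *+ 2 = g) <-> (h = half_elt g).
Proof.
move=> oddG.
have dbl (k : G) : k *+ 2 *+ (#|G|.+1)./2 = k.
  rewrite -mulrnA mul2n -[X in X.*2]uphalfE uphalfK oddG add1n mulrS.
  have /dvdnP[q ->] : (#[k]%g %| #|G|)%N by rewrite -cardsT cardSg ?subsetT.
  by rewrite mulnC mulrnA -(FinRing.zmodXgE #[k]%g) expg_order mul0rn addr0.
rewrite /half_elt; case: pickP => [k /eqP kg|no] /=.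
  split=> [hg|-> //]; by rewrite -(dbl h) hg -kg dbl.
have := no (g *+ (#|G|.+1)./2).
by rewrite -mulrnA mulnC mulrnA dbl eqxx.
Qed.

End TargetGraphs.

(* Main.v *)
Require Import Defs.
From mathcomp Require Import all_boot all_order all_fingroup all_algebra.
From mathcomp Require Import cyclic zify.
Set Implicit Arguments.
Unset Strict Implicit.
Unset Printing Implicit Defensive.
Import GRing.Theory.
Local Open Scope ring_scope.

(** Signs can be absorbed into representatives, so [a] and [b] are adjacent in
the target graph of x exactly when [x] is one of the two classes [a + b] and
[a - b] ([target_cls]). Since doubling is injective in a group of odd order,
these two classes are distinct, and they are nonzero when [a] != [b]: this is
why each edge of the complete graph lies in precisely two target graphs
([card_targets_of_edge]). If an edge lies in the target graphs of x and y with
[x] != [y], choose representatives with a + b = x; then y = a - b or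
y = b - a, and in both cases a and b are the halves of x + y and x - y, in some
order ([common_edge]).

To count the edges of one target graph, send a to the pair {[a], [x - a]}. The
admissible a are all elements except 0, x and x/2, and the only other
element with the same pair as a is x - a, so there are (N - 3)/2 edges
([card_edges_target]).

For the shape of the graph, let X be the cyclic group generated by x. The
neighbours of [a] are [a + x] and [a - x], so every component is the image in
the set of classes of a coset of X. The coset X itself meets each of its classes
in two elements i x and - i x; it folds onto the path [x], [2x], ..., [px] with
p = (m - 1)/2. The path stops at [x], because [0] is not a vertex, and at [px],
because (p + 1) x = - p x. Any other coset a + X is disjoint from - a + X,
because 2a in X would give a in X, so it embeds in the set of classes, as the
cycle of the [a + i x]. One representative r_j for each of the (N/m - 1)/2 pairs
of opposite cosets outside X is provided by [coset_pair_reps], and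
[target_isomorphic] assembles the vertices [(i + 1) x] and [r_j + i x]. *)

(** * Finite simple graphs *)

Lemma in_edges_set2 (T : finType) (H : sgraph T) (u v : T) :
  ([set u; v] \in edges H) = H u v.
Proof.
apply/imsetP/idP => [[[c d]]|uv]; last by exists (u, v); rewrite ?inE.
rewrite inE /= => cd E.
have : c \in [set u; v] by rewrite E set21.
have : d \in [set u; v] by rewrite E set22.
rewrite !inE => /orP[] /eqP dE /orP[] /eqP cE; rewrite cE dE ?adj_irr // in cd.
by rewrite adj_sym.
Qed.

(** The isomorphism is described by its inverse g, which labels the vertices of H
by those of a model graph K. *)
Lemma isomorphic_of_surj (T U : finType) (H : sgraph T) (K : sgraph U)
    (g : U -> T) :
  injective g -> (forall t, exists u, t = g u) ->
  (forall u v, H (g u) (g v) = K u v) -> isomorphic H K.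
Proof.
move=> g_inj g_surj gP.
have bij_g : bijective g.
  apply: (inj_card_bij g_inj); rewrite -(card_codom g_inj).
  apply/subset_leq_card/subsetP.
  by move=> t _; have [u ->] := g_surj t; exact: codom_f.
have [f fK gK] := bij_g; exists f; first by exists g.
by move=> u v; rewrite -gP !gK.
Qed.

(** * Adjacency of inversion classes *)

Section Classes.
Variable G : finZmodType.
Implicit Types a b x y z : G.

Lemma clsP (u : QG G) : exists a (a0 : a != 0), u = cls a0.
Proof.
case: u => A AP; have /imsetP[a] := AP; rewrite inE => a0 E.
by exists a, a0; apply: val_inj.
Qed.

Lemma cls_eq a b (a0 : a != 0) (b0 : b != 0) :
  (cls a0 == cls b0) = (a == b) || (a == - b).
Proof. by rewrite -val_eqE /= inv_class_eq. Qed.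

(** The four signed sums of a and b make up just the two classes [a + b] and
[a - b], so adjacency becomes a condition on target classes, free of signs. *)
Lemma target_cls x a b (a0 : a != 0) (b0 : b != 0) :
  target x (cls a0) (cls b0) = (cls a0 != cls b0) &&
    ((inv_class x == inv_class (a + b)) || (inv_class x == inv_class (a - b))).
Proof.
rewrite targetE; congr (_ && _); rewrite !inv_class_eq opprB opprD.
apply/existsP/idP => [[s /existsP[t /eqP->]]|].
  by case: s; case: t; rewrite /= ?eqxx ?orbT // addrC eqxx !orbT.
rewrite -!orbA; case/or4P=> /eqP->.
- by exists false; apply/existsP; exists false.
- by exists true; apply/existsP; exists true.
- by exists false; apply/existsP; exists true.
- by exists true; apply/existsP; exists false; rewrite addrC.
Qed.

(** Replacing a and b by their opposites changes neither class, so the signs in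
the definition of adjacency can be normalised away. *)
Lemma target_sum x u v : target x u v ->
  exists a b (a0 : a != 0) (b0 : b != 0),
    [/\ u = cls a0, v = cls b0 & a + b = x].
Proof.
case: (clsP u) => a [a0 ->]; case: (clsP v) => b [b0 ->].
rewrite targetE => /andP[_ /existsP[s /existsP[t /eqP->]]].
have sgn0 (r : bool) (c : G) : c != 0 -> signed r c != 0.
  by case: r; rewrite /= ?oppr_eq0.
have clsS (r : bool) (c : G) (c0 : c != 0) : cls c0 = cls (sgn0 r c c0).
  by apply/eqP; rewrite cls_eq; case: r; rewrite /= ?opprK eqxx ?orbT.
by exists (signed s a), (signed t b), (sgn0 s a a0), (sgn0 t b b0).
Qed.

(** * Intersections of target graphs *)

Section Odd.
Hypothesis oddG : odd #|G|.

Lemma double_inj : injective (fun a : G => a + a).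
Proof.
move=> a b; rewrite -!mulr2n => /esym E.
by rewrite ((half_eltP (a *+ 2) a oddG).1 erefl); apply/esym/half_eltP.
Qed.

Lemma double_eq0 a : (a + a == 0) = (a == 0).
Proof. by rewrite -[X in _ == X]addr0 (inj_eq double_inj). Qed.

Lemma addr_half x : half_elt x + half_elt x = x.
Proof. by rewrite -mulr2n; apply/half_eltP. Qed.

Lemma half_double a : half_elt (a + a) = a.
Proof. by apply: double_inj; rewrite addr_half. Qed.

(** a + b = a - b would give 2b = 0, and a + b = b - a would give 2a = 0. *)
Lemma sum_class_neq_diff_class a b : a != 0 -> b != 0 ->
  inv_class (a + b) != inv_class (a - b).
Proof.
move=> a0 b0; rewrite inv_class_eq (inj_eq (addrI a)) opprB negb_or.
rewrite -addr_eq0 double_eq0 b0 /= addrC (inj_eq (addrI b)) -addr_eq0.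
by rewrite double_eq0.
Qed.

(** Once the signs are chosen so that a + b = x, the class of y can only be
[a - b], and the two signs of y merely exchange which of a, b is the half of
x + y. *)
Lemma common_edge x y (x0 : x != 0) (y0 : y != 0) : cls x0 != cls y0 ->
  exists (hs : half_elt (x + y) != 0) (hd : half_elt (x - y) != 0),
    edges (target x) :&: edges (target y) = [set [set cls hs; cls hd]].
Proof.
move=> xy.
have := xy; rewrite cls_eq negb_or -subr_eq0 -addr_eq0 => /andP[d0 s0].
have half0 z : z != 0 -> half_elt z != 0.
  by apply: contraNneq => z0; rewrite -(addr_half z) z0 addr0.
have hs := half0 _ s0; have hd := half0 _ d0; exists hs, hd.
have halfD : half_elt (x + y) + half_elt (x - y) = x.
  by apply: double_inj; rewrite addrACA !addr_half addrACA subrr addr0.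
have halfB : half_elt (x + y) - half_elt (x - y) = y.
  by apply: double_inj; rewrite addrACA -opprD !addr_half opprB addrC addrA subrK.
apply/setP=> e; rewrite !inE; apply/andP/eqP => [[]|->]; last first.
  rewrite !in_edges_set2 !target_cls halfD halfB !eqxx orbT !andbT.
  rewrite cls_eq negb_or -subr_eq0 halfB y0 /=.
  by rewrite -addr_eq0 halfD.
case/imsetP=> -[u v]; rewrite inE /= => /target_sum[a [b [a0 [b0 [-> -> abx]]]]] ->.
rewrite in_edges_set2 target_cls => /andP[ab /orP[]].
  by rewrite abx => yx; case/negP: xy; rewrite eq_sym -val_eqE.
rewrite inv_class_eq => /orP[] /eqP yE.
  have aE : half_elt (x + y) = a.
    by rewrite -abx yE addrACA subrr addr0 half_double.
  have bE : half_elt (x - y) = b.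
    by rewrite -abx yE opprB addrC addrA subrK half_double.
  have -> : cls a0 = cls hs by apply/val_inj; rewrite /= aE.
  by have -> : cls b0 = cls hd by apply/val_inj; rewrite /= bE.
have aE : half_elt (x - y) = a.
  by rewrite -abx yE opprK addrACA subrr addr0 half_double.
have bE : half_elt (x + y) = b.
  by rewrite -abx yE opprB addrC addrA subrK half_double.
have -> : cls a0 = cls hd by apply/val_inj; rewrite /= aE.
have -> : cls b0 = cls hs by apply/val_inj; rewrite /= bE.
exact: setUC.
Qed.

(** The targets of the edge {[a], [b]} are [a + b] and [a - b]. *)
Lemma card_targets_of_edge (e : {set QG G}) : e \in edges (complete (QG G)) ->
  #|[set X : QG G | [exists x : G,
      (val X == inv_class x) && (e \in edges (target x))]]| = 2%N.
Proof.
case/imsetP=> -[u v]; rewrite inE /= /complete_rel /= => uv ->.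
case: (clsP u) uv => a [a0 ->]; case: (clsP v) => b [b0 ->] ab.
have := ab; rewrite cls_eq negb_or -subr_eq0 -addr_eq0 => /andP[d0 s0].
have sd : cls s0 != cls d0 by rewrite -val_eqE sum_class_neq_diff_class.
(* a pair {u, v} has (u != v).+1 elements *)
rewrite -[RHS]/(true.+1) -sd -cards2; apply: eq_card => X; rewrite !inE.
apply/existsP/orP => [[x /andP[/eqP XE]]|].
  rewrite in_edges_set2 target_cls -XE => /andP[_ /orP[]] /eqP E; [left|right].
    by apply/eqP/val_inj.
  by apply/eqP/val_inj.
case=> /eqP ->; [exists (a + b)|exists (a - b)].
  by rewrite in_edges_set2 target_cls ab !eqxx.
by rewrite in_edges_set2 target_cls ab !eqxx orbT.
Qed.

(** * The number of edges of a target graph *)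

(** Written as a set of classes rather than with [cls], so that it is a total
function of a, without proofs that a and x - a are nonzero. *)
Definition class_pair x a : {set QG G} :=
  [set u : QG G | (val u == inv_class a) || (val u == inv_class (x - a))].

Lemma class_pairE x a b (a0 : a != 0) (b0 : b != 0) : a + b = x ->
  class_pair x a = [set cls a0; cls b0].
Proof. by move=> <-; apply/setP=> u; rewrite !inE addrAC subrr add0r. Qed.

Lemma class_pair_sub x a : class_pair x (x - a) = class_pair x a.
Proof. by apply/setP=> u; rewrite !inE subKr orbC. Qed.

(** The reflection of a in x/2 gives the same pair, and nothing else does: the
remaining candidate b = - c, with c = a or c = x - a, is ruled out because
[x - b] = [x + c] would have to be [c] or [x - c], which forces c = 0, x = 0 or
x = 2b. *)
Lemma class_pair_eq x a b : x != 0 -> a != 0 -> x - a != 0 -> b != 0 ->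
  x - b != 0 -> b != half_elt x ->
  (class_pair x b == class_pair x a) = (b == a) || (b == x - a).
Proof.
move=> x0 a0 xa0 b0 xb0 bh.
apply/eqP/orP => [E|[] /eqP-> //]; last exact: class_pair_sub.
have not_opp (c : G) : c != 0 -> class_pair x b = class_pair x c -> b != - c.
  move=> c0 /setP/(_ (cls xb0)); rewrite !inE /= eqxx orbT !inv_class_eq.
  move=> h; apply: contraTneq (esym h) => bE.
  rewrite negb_or !negb_or {1 3 4}bE opprK opprB.
  rewrite -[X in _ == X]add0r (inj_eq (addIr c)) x0 /=.
  apply/and3P; split.
  - apply: contra bh => /eqP; rewrite -bE => /(congr1 (+%R^~ b)).
    by rewrite subrK => ->; rewrite half_double.
  - by rewrite (inj_eq (addrI x)) -addr_eq0 double_eq0.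
  - by rewrite addrC (inj_eq (addrI c)) -addr_eq0 double_eq0.
have : cls b0 \in class_pair x a by rewrite -E inE /= eqxx.
rewrite inE /= !inv_class_eq (negPf (not_opp _ a0 E)) orbF.
rewrite -(class_pair_sub x a) in E.
by rewrite (negPf (not_opp _ xa0 E)) orbF => /orP.
Qed.

(** The edges are the images, under a two-to-one map, of the N - 3 elements
other than 0, x and x/2; the excluded x/2 would give a loop. *)
Lemma card_edges_target x : x != 0 ->
  #|edges (target x)| = ((#|G| - 1) %/ 2 - 1)%N.
Proof.
move=> x0; pose A := [set: G] :\ 0 :\ x :\ half_elt x.
have AP a : reflect [/\ a != 0, x - a != 0 & a != half_elt x] (a \in A).
  by rewrite !inE andbT subr_eq0 (eq_sym x); apply: (iffP and3P) => -[].
have edgesE : edges (target x) = class_pair x @: A.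
  apply/setP=> e; apply/idP/imsetP => [/imsetP[[u v]]|[a /AP[a0 xa0 ah] ->]].
    rewrite inE /= => uv ->; have: target x u v := uv.
    case/target_sum: uv => a [b [a0 [b0 [-> -> abx]]]].
    rewrite targetE => /andP[ab _]; exists a; last by rewrite (class_pairE a0 b0).
    apply/AP; split=> //; first by rewrite -abx addrAC subrr add0r.
    apply: contra ab => /eqP ah; rewrite cls_eq -(inj_eq (addrI a)) abx.
    by rewrite {1 2}ah addr_half eqxx.
  rewrite (class_pairE a0 xa0) ?[a + _]addrC ?subrK // in_edges_set2 target_cls.
  rewrite [a + _]addrC subrK eqxx andbT cls_eq negb_or; apply/andP; split.
    by apply: contra ah => /eqP ah; rewrite -(subrK a x) -ah half_double.
  by rewrite opprB -subr_eq0 opprB addrCA subrr addr0.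
have fibre e : e \in class_pair x @: A ->
    (\sum_(a in A | class_pair x a == e) 1 = 2)%N.
  case/imsetP=> a aA ->; case/AP: (aA) => a0 xa0 ah.
  have axa : a != x - a.
    by apply: contra ah => /eqP ah; rewrite -(subrK a x) -ah half_double.
  rewrite sum1_card -[RHS]/(true.+1) -axa -cards2; apply: eq_card => b.
  rewrite !inE -topredE /=; apply/andP/idP => [[/AP[b0 xb0 bh]]|].
    by rewrite class_pair_eq.
  case/orP=> /eqP ->; first by split.
  split; last by rewrite class_pair_sub.
  apply/AP; rewrite subKr; split=> //.
  apply: contra axa => /eqP h.
  by rewrite -{1}(subKr x a) h -{1}(addr_half x) addrK.
have cardA : #|A| = (#|edges (target x)| * 2)%N.
  rewrite edgesE -sum_nat_const -(eq_bigr _ fibre) -sum1_card.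
  exact: partition_big_imset.
have h0 : half_elt x != 0.
  by apply: contraNneq x0 => h; rewrite -(addr_half x) h addr0.
have hx : half_elt x != x.
  apply: contraNneq x0 => h; have := addr_half x; rewrite h => /eqP.
  by rewrite -subr_eq0 addrK.
have := cardsD1 (half_elt x) ([set: G] :\ 0 :\ x); rewrite -/A cardA.
have := cardsD1 x ([set: G] :\ 0); have := cardsD1 0 [set: G].
rewrite !inE x0 h0 hx cardsT /=.
move=> -> -> ->; set n := #|_|; lia.
Qed.

(** * Pairs of opposite cosets *)

Section Subgroup.
Variable X : {group G}.

Lemma group_addl a b : a \in X -> (a + b \in X) = (b \in X).
Proof. by move=> aX; rewrite -FinRing.zmodMgE groupMl. Qed.

Lemma group_opp a : (- a \in X) = (a \in X).
Proof. by rewrite -FinRing.zmodVgE groupV. Qed.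

(** Halving is multiplication by (N + 1)/2, and so preserves subgroups. *)
Lemma group_double a : (a + a \in X) = (a \in X).
Proof.
apply/idP/idP => [aaX|aX]; last by rewrite group_addl.
have aN : a *+ #|G| = 0.
  by rewrite -FinRing.zmodXgE -cardsT (@expg_cardG _ [set: G]%G) ?inE.
have -> : a = (a + a) *+ uphalf #|G|.
  by rewrite -mulr2n -mulrnA mul2n uphalfK oddG add1n mulrS aN addr0.
by rewrite -FinRing.zmodXgE groupX.
Qed.

Definition same_coset_pm : rel G := fun a b => (a - b \in X) || (a + b \in X).

Lemma same_coset_pm_equiv : equivalence_rel same_coset_pm.
Proof.
move=> a b c; split=> [|/orP[] h]; rewrite /same_coset_pm.
- by rewrite subrr -FinRing.zmod1gE group1.
- rewrite -(group_addl (b - c) h) -(group_addl (b + c) h).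
  by rewrite !addrA !subrK.
- have E d : (a - d \in X) = (b + d \in X).
    by rewrite -[RHS]group_opp -(group_addl (- (b + d)) h) opprD addrA addrK.
  by have := E (- c); rewrite opprK E orbC => ->.
Qed.

(** The cosets of a and - a are disjoint, for otherwise 2a would be in X. *)
Lemma card_coset_pair a : a \notin X ->
  #|[set b in ~: X | same_coset_pm a b]| = (2 * #|X|)%N.
Proof.
move=> aX.
have -> : [set b in ~: X | same_coset_pm a b] = ((a *: X) :|: (- a *: X))%g.
  apply/setP=> b; rewrite !inE !mem_lcoset !FinRing.zmodVgE !FinRing.zmodMgE opprK.
  rewrite /same_coset_pm -[a - b \in X]group_opp opprB addrC [- a + b]addrC.
  rewrite andb_idl // => /orP[] h; apply: contra aX => bX.
    by rewrite -group_opp -(group_addl _ bX).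
  by rewrite -(group_addl _ bX) addrC.
rewrite cardsU !card_lcoset disjoint_setI0 ?cards0 ?subn0 ?mul2n ?addnn //.
rewrite disjoint_subset; apply/subsetP=> b; rewrite !inE !mem_lcoset.
rewrite !FinRing.zmodVgE !FinRing.zmodMgE opprK => h; apply: contra aX => h'.
by rewrite -group_double -(group_addl _ h) addrACA addNr add0r addrC.
Qed.

(** The unions of two opposite cosets partition the complement of X into blocks
of size 2 |X|, which gives the number of representatives. *)
Lemma coset_pair_reps : exists r : 'I_((#|G| %/ #|X| - 1) %/ 2) -> G,
  [/\ forall j, r j \notin X, forall j k, same_coset_pm (r j) (r k) -> j = k
    & forall a, a \notin X -> exists j, same_coset_pm (r j) a].
Proof.
pose P := equivalence_partition same_coset_pm (~: X).
have eqR : {in ~: X & &, equivalence_rel same_coset_pm}.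
  by move=> a b c _ _ _; exact: same_coset_pm_equiv.
have partP : partition P (~: X) := equivalence_partitionP eqR.
have trP := transversalP partP; set T := transversal P (~: X) in trP.
have TX a : a \in T -> a \in ~: X := subsetP (transversal_sub trP) a.
have cardT : #|T| = ((#|G| %/ #|X| - 1) %/ 2)%N.
  rewrite (card_transversal trP).
  have cardA : {in P, forall A : {set G}, #|A| = (2 * #|X|)%N}.
    by move=> A /imsetP[a]; rewrite inE => aX ->; exact: card_coset_pair.
  have := card_uniform_partition cardA partP.
  have := cardsC X; have /dvdnP[q] := cardSg (subsetT X).
  rewrite cardsT => -> E F; have X0 := cardG_gt0 X.
  have -> : q = (#|P| * 2).+1.
    by apply/eqP; rewrite -(eqn_pmul2r X0) -E F mulnA.
  by rewrite mulnK // subn1 /= mulnK.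
rewrite -cardT; exists enum_val; split.
- by move=> j; have := TX _ (enum_valP j); rewrite inE.
- move=> j k R; have [Tj Tk] := (enum_valP j, enum_valP k).
  apply: enum_val_inj; apply: (pblock_inj trP) => //; apply/eqP.
  rewrite eq_pblock ?(partition_trivIset partP) ?(cover_partition partP) ?TX //.
  by rewrite (pblock_equivalence_partition eqR) ?TX.
- move=> a aX; have aD : a \in ~: X by rewrite inE.
  have aP : pblock P a \in P by rewrite pblock_mem // (cover_partition partP).
  have bT := repr_mem_transversal trP 0 aP.
  have bP := repr_mem_pblock trP 0 aP; move: bT bP.
  set b := transversal_repr _ _ _ => bT.
  rewrite (pblock_equivalence_partition eqR aD (TX _ bT)) => ab.
  exists (enum_rank_in bT b); rewrite enum_rankK_in //.
  by have [aa /(_ ab) <-] := same_coset_pm_equiv a b a.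
Qed.
End Subgroup.

(** * Path and cycles *)

Section Target.
Variable x : G.
Let m := #[x]%g.

Lemma odd_order : odd m.
Proof.
by apply: dvdn_odd oddG; rewrite /m -cardsT order_dvdG ?inE.
Qed.

Lemma mulrn_order_eq0 i : (x *+ i == 0) = (m %| i)%N.
Proof. by rewrite order_dvdn FinRing.zmodXgE. Qed.

Lemma mulrn_order_eq i j : (x *+ i == x *+ j) = (i == j %[mod m])%N.
Proof. by rewrite -eq_expg_mod_order !FinRing.zmodXgE. Qed.

Lemma mulrn_in_cycle i : x *+ i \in <[x]>%g.
Proof. by rewrite -FinRing.zmodXgE mem_cycle. Qed.

Lemma in_cycle_mulrn a : a \in <[x]>%g -> exists2 i, (i < m)%N & a = x *+ i.
Proof. by case/cyclePmin=> i im ->; exists i; rewrite ?FinRing.zmodXgE. Qed.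

Lemma path_vertex_neq0 (i : 'I_((m - 1) %/ 2)) : x *+ i.+1 != 0.
Proof.
rewrite mulrn_order_eq0 gtnNdvd //; have := ltn_ord i; lia.
Qed.

(** All indices involved are small enough to be compared without reduction
modulo m, with one exception: [a + b] = [x] holds for a = b = (m - 1)/2 times x,
but there the two classes coincide. *)
Lemma target_path_part (i j : 'I_((m - 1) %/ 2)) :
  (cls (path_vertex_neq0 i) == cls (path_vertex_neq0 j) -> i = j) /\
  target x (cls (path_vertex_neq0 i)) (cls (path_vertex_neq0 j))
    = path_graph _ i j.
Proof.
have [ip jp] := (ltn_ord i, ltn_ord j); have om := odd_order.
have pm : (((m - 1) %/ 2).+1 < m)%N by lia.
have clsE : (cls (path_vertex_neq0 i) == cls (path_vertex_neq0 j)) = (i == j).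
  rewrite cls_eq mulrn_order_eq -addr_eq0 -mulrnDr mulrn_order_eq0.
  rewrite gtnNdvd ?orbF ?modn_small //; lia.
split=> [|]; first by rewrite clsE => /eqP.
rewrite target_cls clsE !inv_class_eq -mulrnDr opprB /= /path_rel /=.
have -> : (x == x *+ (i.+1 + j.+1)) = false.
  rewrite -{1}[x]mulr1n mulrn_order_eq !modn_small; lia.
have -> : (x == - (x *+ (i.+1 + j.+1))) = (i.+1 + j.+2 == m)%N.
  rewrite -addr_eq0 -mulrS mulrn_order_eq0; apply/idP/eqP => [/dvdn_leq|]; first lia.
  by move=> E; rewrite (_ : (i.+1 + j.+1).+1 = m) //; lia.
have shift (k l : 'I_((m - 1) %/ 2)) :
    (x == x *+ k.+1 - x *+ l.+1) = (l.+1 == k :> nat).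
  rewrite eq_sym subr_eq -mulrS mulrn_order_eq.
  by have [kp lp] := (ltn_ord k, ltn_ord l); rewrite !modn_small; lia.
rewrite !shift -val_eqE /=; lia.
Qed.

Variable k : nat.
Variable r : 'I_k -> G.
Hypothesis r_notin : forall j, r j \notin <[x]>%g.
Hypothesis r_sep : forall j l, same_coset_pm <[x]>%G (r j) (r l) -> j = l.

Lemma cycle_vertex_neq0 (q : 'I_k * 'I_m) : r q.1 + x *+ q.2 != 0.
Proof.
apply: contra (r_notin q.1); rewrite addr_eq0 => /eqP ->.
by rewrite group_opp mulrn_in_cycle.
Qed.

Lemma cycle_vertex_diff (q t : 'I_k * 'I_m) :
  (r q.1 + x *+ q.2) - (r t.1 + x *+ t.2) \in <[x]>%g -> q.1 = t.1.
Proof.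
rewrite opprD addrACA addrC group_addl => [h|].
  by apply: r_sep; rewrite /same_coset_pm h.
by rewrite group_addl ?group_opp mulrn_in_cycle.
Qed.

(** No sum of two vertices lies in the cyclic group: the representatives would
be opposite modulo it, hence equal, and their double would belong to it. Thus only
differences of representatives can produce the target x. *)
Lemma cycle_vertex_sum (q t : 'I_k * 'I_m) :
  (r q.1 + x *+ q.2) + (r t.1 + x *+ t.2) \notin <[x]>%g.
Proof.
rewrite addrACA addrC group_addl -?mulrnDr ?mulrn_in_cycle //.
have [h|//] := boolP (r q.1 + r t.1 \in _); have := h.
have -> : q.1 = t.1 by apply: r_sep; rewrite /same_coset_pm h orbT.
by rewrite group_double (negPf (r_notin _)).
Qed.

Lemma cls_cycle_vertex_eq (q t : 'I_k * 'I_m) :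
  (cls (cycle_vertex_neq0 q) == cls (cycle_vertex_neq0 t)) = (q == t).
Proof.
rewrite cls_eq -addr_eq0 [X in _ || X](_ : _ = false) ?orbF; last first.
  by apply: contraNF (cycle_vertex_sum q t) => /eqP ->; rewrite -FinRing.zmod1gE group1.
apply/eqP/eqP => [|-> //]; case: q t => [j i] [l n] /= E.
have jl : j = l.
  apply: (@cycle_vertex_diff (j, i) (l, n)).
  by rewrite /= E subrr -FinRing.zmod1gE group1.
move: E; rewrite jl => /addrI /eqP; rewrite mulrn_order_eq !modn_small // => /eqP E.
by congr (_, _); apply: val_inj.
Qed.

Lemma target_cycle_part (q t : 'I_k * 'I_m) :
  target x (cls (cycle_vertex_neq0 q)) (cls (cycle_vertex_neq0 t))
    = copies (cycle_graph m) k q t.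
Proof.
rewrite target_cls cls_cycle_vertex_eq.
have xX : x \in <[x]>%g by rewrite cycle_id.
rewrite !inv_class_eq opprB.
have notsum y : y \in <[x]>%g ->
    (y == r q.1 + x *+ q.2 + (r t.1 + x *+ t.2)) = false.
  by move=> yX; apply: contraNF (cycle_vertex_sum q t) => /eqP <-.
rewrite -[x == - _]eqr_oppLR !notsum ?group_opp //=.
case: q t {notsum} => [j i] [l n]; rewrite /copies_rel /cycle_rel /=.
have [<-|jl] /= := eqVneq j l; last first.
  apply/negbTE; rewrite negb_and; apply/orP; right; rewrite negb_or.
  apply/andP; split; apply: contra jl => /eqP E; apply/eqP.
    by apply: (@cycle_vertex_diff (j, i) (l, n)); rewrite /= -E.
  by apply/esym/(@cycle_vertex_diff (l, n) (j, i)); rewrite /= -E.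
have shift (a b : 'I_m) : (x == r j + x *+ a - (r j + x *+ b)) = (a == ordS b).
  rewrite eq_sym subr_eq addrCA (inj_eq (addrI _)) -mulrS mulrn_order_eq.
  by rewrite -val_eqE /= [(a %% m)%N]modn_small.
by rewrite !shift xpair_eqE eqxx /= orbC.
Qed.

Lemma path_cycle_neq (i : 'I_((m - 1) %/ 2)) (q : 'I_k * 'I_m) :
  cls (path_vertex_neq0 i) != cls (cycle_vertex_neq0 q).
Proof.
rewrite cls_eq negb_or; apply/andP; split; apply: contra (r_notin q.1) => /eqP E.
  by rewrite -(group_addl _ (mulrn_in_cycle q.2)) addrC -E mulrn_in_cycle.
rewrite -(group_addl _ (mulrn_in_cycle q.2)) addrC -group_opp -E.
exact: mulrn_in_cycle.
Qed.

Lemma target_path_cycle (i : 'I_((m - 1) %/ 2)) (q : 'I_k * 'I_m) :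
  target x (cls (path_vertex_neq0 i)) (cls (cycle_vertex_neq0 q)) = false.
Proof.
have key y : y \in <[x]>%g -> y - (r q.1 + x *+ q.2) \notin <[x]>%g.
  move=> yX; rewrite group_addl // group_opp addrC group_addl ?r_notin //.
  exact: mulrn_in_cycle.
have key' y : y \in <[x]>%g -> y + (r q.1 + x *+ q.2) \notin <[x]>%g.
  move=> yX; rewrite group_addl // addrC group_addl ?r_notin //.
  exact: mulrn_in_cycle.
have xX : x \in <[x]>%g by rewrite cycle_id.
have iX := mulrn_in_cycle i.+1.
apply/negbTE; rewrite target_cls negb_and !inv_class_eq -![x == - _]eqr_oppLR.
rewrite !negb_or -!andbA; apply/orP; right; apply/and4P; split.
- by apply: contraNneq (key' _ iX) => <-.
- by apply: contraNneq (key' _ iX) => <-; rewrite group_opp.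
- by apply: contraNneq (key _ iX) => <-.
- by apply: contraNneq (key _ iX) => <-; rewrite group_opp.
Qed.
End Target.

(** It remains to see that every class is reached: a multiple i x of x is, up to
sign, one with i <= (m - 1)/2, and any other element is, up to sign, in the
coset of some representative. *)
Lemma target_isomorphic x :
  isomorphic (target x)
    (disjoint_union (path_graph ((#[x]%g - 1) %/ 2)%N)
       (copies (cycle_graph #[x]%g) ((#|G| %/ #[x]%g - 1) %/ 2)%N)).
Proof.
have [r [r_notin r_sep r_all]] := coset_pair_reps <[x]>%G.
pose g (s : 'I_((#[x]%g - 1) %/ 2) + 'I_((#|G| %/ #[x]%g - 1) %/ 2) * 'I_#[x]%g) :=
  match s with
  | inl i => cls (path_vertex_neq0 i)
  | inr q => cls (cycle_vertex_neq0 r_notin q)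
  end.
apply: (@isomorphic_of_surj _ _ _ _ g).
- move=> [i|q] [j|t] /= /eqP E.
  + by congr inl; apply: (target_path_part i j).1.
  + by rewrite (negPf (path_cycle_neq _ _ _)) in E.
  + by rewrite eq_sym (negPf (path_cycle_neq _ _ _)) in E.
  + by congr inr; apply/eqP; rewrite -(cls_cycle_vertex_eq r_notin).
- move=> u; have [a [a0 ->]] := clsP u.
  have [aX|aX] := boolP (a \in <[x]>%g).
    have [i im aE] := in_cycle_mulrn aX.
    have i0 : (0 < i)%N by rewrite lt0n; apply: contraNneq a0 => i0; rewrite aE i0.
    have om := odd_order x; set m := #[x]%g in im om *.
    have [ip|ip] := leqP i ((m - 1) %/ 2).
      have ip' : (i.-1 < (m - 1) %/ 2)%N by lia.
      exists (inl (Ordinal ip')); apply/eqP.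
      by rewrite cls_eq /= prednK // aE eqxx.
    have ip' : ((m - i).-1 < (m - 1) %/ 2)%N by lia.
    exists (inl (Ordinal ip')); apply/eqP; rewrite cls_eq /= prednK ?subn_gt0 //.
    by rewrite -addr_eq0 aE -mulrnDr subnKC ?(ltnW im) // mulrn_order_eq0 dvdnn orbT.
  have [j raX] := r_all a aX.
  have [i im aE] : exists2 i, (i < #[x]%g)%N &
      (a == r j + x *+ i) || (a == - (r j + x *+ i)).
    case/orP: raX; rewrite -group_opp => /in_cycle_mulrn[i im E].
      by exists i; rewrite // -E opprB addrC subrK eqxx.
    by exists i; rewrite // -E opprD addrA subrr add0r opprK eqxx orbT.
  by exists (inr (j, Ordinal im)); apply/eqP; rewrite cls_eq.
- move=> [i|q] [j|t]; rewrite /g.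
  + exact: (target_path_part i j).2.
  + exact: target_path_cycle.
  + by rewrite adj_sym; apply: target_path_cycle.
  + exact: target_cycle_part.
Qed.

End Odd.
End Classes.

Theorem theorem4p1 (G : finZmodType) (oddG : odd #|G|) :
  let N := #|G| in
  let M := ((N - 1) %/ 2)%N in
  [/\ forall x : G, x != 0 ->
        let m := #[x]%g in
        isomorphic (target x)
          (disjoint_union (path_graph ((m - 1) %/ 2)%N)
             (copies (cycle_graph m) ((N %/ m - 1) %/ 2)%N)),
      forall x : G, x != 0 -> #|edges (target x)| = (M - 1)%N,
      forall e : {set QG G}, e \in edges (complete (QG G)) ->
        #|[set X : QG G | [exists x : G,
            (val X == inv_class x) && (e \in edges (target x))]]| = 2%N
    & forall (x y : G) (x0 : x != 0) (y0 : y != 0), cls x0 != cls y0 ->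
        exists (hs : half_elt (x + y) != 0) (hd : half_elt (x - y) != 0),
          edges (target x) :&: edges (target y) = [set [set cls hs; cls hd]]].
Proof.
split.
- by move=> x _; exact: target_isomorphic.
- exact: card_edges_target.
- exact: card_targets_of_edge.
- exact: common_edge.
Qed.
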